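(* Let $f$ and $g$ be two positive integrable functions on $[0,\infty)$, let $x>0$, let $p_1\in(0,1]$, and let $\alpha\in(n,n+1]$ for some $n\in\{1,2,3,\dots\}$. Let $v_1,v_2,w_1,w_2$ be positive functions such that $0<v_1(\tau)\le f(\tau)\le v_2(\tau)$ and $0<w_1(\tau)\le g(\tau)\le w_2(\tau)$ for all $\tau\in[0,x]$. Then $$\frac{I^{\alpha,p_1}[w_1w_2f^2](x)\; I^{\alpha,p_1}[v_1v_2g^2](x)}{\Big(I^{\alpha,p_1}\big[(v_1w_1+v_2w_2)fg\big](x)\Big)^2}\le\frac14 .$$
   Context: For $\alpha>0$, $p\in(0,1]$ and $x>0$, the (left, based at $0$) generalized proportional fractional (GPF) integral operator is $$I^{\alpha,p}[h](x)=\frac{1}{p^{\alpha}\Gamma(\alpha)}\int_0^x e^{\frac{p-1}{p}(x-\tau)}(x-\tau)^{\alpha-1}h(\tau)\,d\tau ,$$ where $\Gamma$ is the Gamma function. All fractional integrals written in the statement are understood to exist as finite numbers (in particular the functions involved are measurable). *)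

(* Defs.v *)
From mathcomp Require Import all_boot all_order all_algebra.
From mathcomp Require Import all_classical all_reals all_analysis.

Set Implicit Arguments.
Unset Strict Implicit.
Unset Printing Implicit Defensive.

Import Order.TTheory GRing.Theory Num.Theory.
Import numFieldNormedType.Exports.

Local Open Scope classical_set_scope.
Local Open Scope ring_scope.

(* Integrals are taken for the completed Lebesgue measure, so that
   "measurable" means Lebesgue measurable and not merely Borel. *)
Definition Gamma (R : realType) (a : R) : R :=
  \int[@completed_lebesgue_measure R]_(t in `]0, +oo[) (t `^ (a - 1) * expR (- t)).

Definition gpf_integrand (R : realType) (alpha p : R) (h : R -> R) (x tau : R) : R :=
  expR ((p - 1) / p * (x - tau)) * (x - tau) `^ (alpha - 1) * h tau.

(* [Rintegral] is total (it is [0] when the integral is not finite), so the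
   existence of the integral is the separate predicate [gpf_exists]. *)
Definition gpf (R : realType) (alpha p : R) (h : R -> R) (x : R) : R :=
  (p `^ alpha * Gamma alpha)^-1 *
  \int[@completed_lebesgue_measure R]_(tau in `[0, x]) gpf_integrand alpha p h x tau.

Definition gpf_exists (R : realType) (alpha p : R) (h : R -> R) (x : R) : Prop :=
  (@completed_lebesgue_measure R).-integrable `[0, x]
    (EFin \o gpf_integrand alpha p h x).

(* Main.v *)
Require Import Defs.
From mathcomp Require Import all_boot all_order all_algebra.
From mathcomp Require Import all_classical all_reals all_analysis.
From mathcomp Require Import ring lra.
Import Order.TTheory GRing.Theory Num.Theory.
Import numFieldNormedType.Exports.
Local Open Scope classical_set_scope.
Local Open Scope ring_scope.

(** Let a, b and c be the values of the operator at x on w1 w2 f^2, v1 v2 g^2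
    and (v1 w1 + v2 w2) f g.  The bounds say v1/w2 <= f/g <= v2/w1, so
    (f/g - v1/w2) (v2/w1 - f/g) >= 0 at each point of [0, x].  Clearing the
    denominators gives the Diaz-Metcalf type inequality
      w1 w2 f^2 + v1 v2 g^2 <= (v1 w1 + v2 w2) f g
    ([diaz_metcalf_pointwise]).  The operator is additive ([gpfD]);
    it is also positive ([gpf_ge0]) and monotone ([le_gpf]), because its kernel
    and its normalising constant are nonnegative.  Hence a + b <= c with a and b nonnegative, and
    4 a b <= (a + b)^2 <= c^2. *)

(** Borel sets stay measurable for the completed measure, whose sigma-algebra
    is the Caratheodory one of the length outer measure. *)
Lemma measurable_completed_itv (R : realType) (i : interval R) :
  ((wlength idfun)^*%mu).-cara.-measurable [set` i].
Proof. exact: sub_caratheodory (measurable_itv i). Qed.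

Lemma Gamma_ge0 (R : realType) (a : R) : 0 <= Gamma a.
Proof.
by apply: Rintegral_ge0 => t _; rewrite mulr_ge0 ?powR_ge0 ?expR_ge0.
Qed.

Lemma gpf_const_ge0 (R : realType) (alpha p : R) :
  0 <= (p `^ alpha * Gamma alpha)^-1.
Proof. by rewrite invr_ge0 mulr_ge0 ?powR_ge0 ?Gamma_ge0. Qed.

Section GpfOrder.
Set Implicit Arguments.
Context {R : realType}.
Implicit Types (alpha p x : R) (h k : R -> R).

Lemma le_gpf_integrand alpha p h k x t :
  h t <= k t -> gpf_integrand alpha p h x t <= gpf_integrand alpha p k x t.
Proof. by move=> hk; rewrite ler_wpM2l// mulr_ge0 ?powR_ge0 ?expR_ge0. Qed.

Lemma gpf_integrand_ge0 alpha p h x t :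
  0 <= h t -> 0 <= gpf_integrand alpha p h x t.
Proof. by move=> h0; rewrite !mulr_ge0 ?powR_ge0 ?expR_ge0. Qed.

Lemma gpf_integrandD alpha p h k x :
  gpf_integrand alpha p (h \+ k) x =
  gpf_integrand alpha p h x \+ gpf_integrand alpha p k x.
Proof. by apply/funext => t; rewrite /gpf_integrand /= mulrDr. Qed.

Lemma gpf_existsD alpha p h k x :
  gpf_exists alpha p h x -> gpf_exists alpha p k x ->
  gpf_exists alpha p (h \+ k) x.
Proof.
move=> hi ki; rewrite /gpf_exists gpf_integrandD.
exact: (integrableD (measurable_completed_itv R _) hi ki).
Qed.

Lemma gpfD alpha p h k x :
  gpf_exists alpha p h x -> gpf_exists alpha p k x ->
  gpf alpha p (h \+ k) x = gpf alpha p h x + gpf alpha p k x.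
Proof.
move=> hi ki; rewrite /gpf -mulrDr gpf_integrandD.
by rewrite (RintegralD (measurable_completed_itv R _) hi ki).
Qed.

Lemma gpf_ge0 alpha p h x :
  (forall t, 0 <= t <= x -> 0 <= h t) -> 0 <= gpf alpha p h x.
Proof.
move=> h0; rewrite mulr_ge0 ?gpf_const_ge0// Rintegral_ge0// => t.
by rewrite /= in_itv => /h0; exact: gpf_integrand_ge0.
Qed.

Lemma le_gpf alpha p h k x :
  gpf_exists alpha p h x -> gpf_exists alpha p k x ->
  (forall t, 0 <= t <= x -> h t <= k t) ->
  gpf alpha p h x <= gpf alpha p k x.
Proof.
move=> hi ki hk; rewrite ler_wpM2l ?gpf_const_ge0//.
apply: (le_Rintegral (measurable_completed_itv R _) hi ki) => t.
by rewrite /= in_itv => /hk; exact: le_gpf_integrand.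
Qed.

End GpfOrder.

(** The two sides differ by (w2 f - v1 g) (v2 g - w1 f), whose factors compare
    f / g with v1 / w2 and v2 / w1; this form avoids any division. *)
Lemma diaz_metcalf_pointwise (R : realDomainType) (f g v1 v2 w1 w2 : R) :
  0 <= v1 <= f -> f <= v2 -> 0 <= w1 <= g -> g <= w2 ->
  w1 * w2 * f ^+ 2 + v1 * v2 * g ^+ 2 <= (v1 * w1 + v2 * w2) * (f * g).
Proof.
move=> /andP[v10 v1f] fv2 /andP[w10 w1g] gw2; rewrite -subr_ge0.
have -> : (v1 * w1 + v2 * w2) * (f * g) - (w1 * w2 * f ^+ 2 + v1 * v2 * g ^+ 2)
          = (w2 * f - v1 * g) * (v2 * g - w1 * f) by ring.
have f0 := le_trans v10 v1f; have g0 := le_trans w10 w1g.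
by apply: mulr_ge0; rewrite subr_ge0 [leRHS]mulrC ler_pM.
Qed.

(** The case c = 0 is included: the quotient is then 0 by the convention
    0^-1 = 0. *)
Lemma mul_div_sqr_le_quarter (R : realFieldType) (a b c : R) :
  0 <= a -> 0 <= b -> a + b <= c -> a * b / c ^+ 2 <= 1 / 4%:R.
Proof.
move=> a0 b0 abc; have [->|c0] := eqVneq c 0.
  by rewrite expr0n invr0 mulr0 divr_ge0.
have c2 : 0 < c ^+ 2 by rewrite exprn_even_gt0.
rewrite ler_pdivrMr//.
have ab0 : 0 <= a + b by exact: addr_ge0.
have : (a + b) ^+ 2 <= c ^+ 2 by rewrite lerXn2r ?nnegrE// (le_trans ab0).
have := sqr_ge0 (a - b); lra.
Qed.

Theorem lemma1 (R : realType) (f g v1 v2 w1 w2 : R -> R) (x p1 alpha : R) (n : nat)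
  (f_int : (@completed_lebesgue_measure R).-integrable `[0, +oo[ (EFin \o f))
  (g_int : (@completed_lebesgue_measure R).-integrable `[0, +oo[ (EFin \o g))
  (f_gt0 : forall t : R, 0 <= t -> 0 < f t)
  (g_gt0 : forall t : R, 0 <= t -> 0 < g t)
  (x_gt0 : 0 < x)
  (p1_bounds : 0 < p1 <= 1)
  (n_ge1 : (1 <= n)%N)
  (alpha_bounds : n%:R < alpha <= n.+1%:R)
  (f_bounds : forall t : R, 0 <= t <= x -> 0 < v1 t /\ v1 t <= f t /\ f t <= v2 t)
  (g_bounds : forall t : R, 0 <= t <= x -> 0 < w1 t /\ w1 t <= g t /\ g t <= w2 t)
  (ex_f : gpf_exists alpha p1 (fun t => w1 t * w2 t * f t ^+ 2) x)
  (ex_g : gpf_exists alpha p1 (fun t => v1 t * v2 t * g t ^+ 2) x)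
  (ex_fg : gpf_exists alpha p1
     (fun t => (v1 t * w1 t + v2 t * w2 t) * (f t * g t)) x) :
  gpf alpha p1 (fun t => w1 t * w2 t * f t ^+ 2) x
    * gpf alpha p1 (fun t => v1 t * v2 t * g t ^+ 2) x
    / (gpf alpha p1 (fun t => (v1 t * w1 t + v2 t * w2 t) * (f t * g t)) x) ^+ 2
  <= 1 / 4%:R.
Proof.
apply: mul_div_sqr_le_quarter.
- apply: gpf_ge0 => t tx.
  have [w10 [w1g gw2]] := g_bounds t tx.
  have w20 := lt_le_trans w10 (le_trans w1g gw2).
  by rewrite mulr_ge0 ?sqr_ge0// mulr_ge0 ?(ltW w10) ?(ltW w20).
- apply: gpf_ge0 => t tx.
  have [v10 [v1f fv2]] := f_bounds t tx.
  have v20 := lt_le_trans v10 (le_trans v1f fv2).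
  by rewrite mulr_ge0 ?sqr_ge0// mulr_ge0 ?(ltW v10) ?(ltW v20).
- rewrite -(gpfD ex_f ex_g).
  apply: le_gpf (gpf_existsD ex_f ex_g) ex_fg _ => t tx.
  have [v10 [v1f fv2]] := f_bounds t tx.
  have [w10 [w1g gw2]] := g_bounds t tx.
  by apply: diaz_metcalf_pointwise; rewrite ?(ltW v10) ?(ltW w10).
Qed.
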